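(* Let $A=KQ/I$ be a gentle algebra. The classes of the following elements, where $a,b\in Q_1$ and $e\in Q_0$, form a basis of $HH_1(A)^*$: (1) $(a,b^* )-(b,a^* )\in K(Q_1\odot\mathcal{B}^* )$, where $ab,ba\in I$ (one element for each unordered pair $\{a,b\}$ of distinct arrows); (2) $(a,e^* )\in K(Q_1\odot\mathcal{B}^* )$ (so $a$ is a loop at $e$); (3) if $\operatorname{char}K=2$, in addition to the elements $(a,b^* )-(b,a^* )$ with $ab,ba\in I$ and the elements $(a,e^* )$ with $a$ a loop at $e$, also the elements $(a,a^* )\in K(Q_1\odot\mathcal{B}^* )$ (so $a$ is a loop).
   Context: $K$ is a field; all algebras are finite dimensional and indecomposable. Paths in a quiver are composed right to left ($ba$ means first $a$, then $b$); $s,t$ denote source and target; vertices are identified with trivial paths. A gentle algebra is $A=KQ/I$ (finite dimensional), with $Q$ a finite connected quiver, such that: (1) at each vertex at most two arrows end and at most two arrows start; (2) for every arrow $a$ there is at most one arrow $b$ with $s(a)=t(b)$ and $ab\notin I$, and at most one arrow $c$ with $s(c)=t(a)$ and $ca\notin I$; (3) for every arrow $a$ there is at most one arrow $b$ with $s(a)=t(b)$ and $ab\in I$, and at most one arrow $c$ with $s(c)=t(a)$ and $ca\in I$; (4) $I$ is generated by paths of length $2$. Standing assumption: $A$ is neither $K$ (one vertex, no arrow) nor $K[x]/(x^2)$ (one vertex, one loop). $R$ is the minimal set of paths of length $2$ generating $I$; $\mathcal{B}$ is the set of paths of $Q$ (including trivial ones) containing no element of $R$ as a subpath; it is a $K$-basis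 of $A$, and $\mathcal{B}^*=\{p^*:p\in\mathcal{B}\}$ is the dual basis of $DA=\operatorname{Hom}_K(A,K)$, with bimodule structure $(xfy)(z)=f(yzx)$. Two paths $p,q$ are a cyclic pair if $s(p)=t(q)$ and $t(p)=s(q)$; for sets of paths $X,Y$, $X\odot Y^*$ is the set of $(p,q^* )$ with $p\in X$, $q\in Y$ and $p,q$ a cyclic pair; $K(X\odot Y^* )$ is the vector space with basis $X\odot Y^*$. $HH_1(A)^*$, the $K$-dual of the first Hochschild homology, is isomorphic to $H^1(A,DA)$ and is identified with $\operatorname{Ker}d_1/\operatorname{Im}d_0$ for the complex $0\to K(Q_0\odot\mathcal{B}^* )\xrightarrow{d_0}K(Q_1\odot\mathcal{B}^* )\xrightarrow{d_1}K(R\odot\mathcal{B}^* )$ with $$d_0(e,p^* )=\sum_{a\in Q_1,\,s(a)=e}\chi_{\mathcal{B}^*}(ap^* )(a,ap^* )-\sum_{a\in Q_1,\,t(a)=e}\chi_{\mathcal{B}^*}(p^*a)(a,p^*a),\qquad d_1(a,p^* )=\sum_{q\in R,\ q=\theta a\nu}\chi_{\mathcal{B}^*}(\theta p^*\nu)(q,\theta p^*\nu),$$ the last sum being over all $q\in R$ and all factorisations $q=\theta a\nu$ with $\theta,\nu$ paths; $\chi_{\mathcal{B}^*}$ is the indicator function of $\mathcal{B}^*$. (So $ap^*=r^*$ if $p=ra$, and $p^*a=r^*$ if $p=ar$, and these are $0$ otherwise.) *)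

(* Defs.v *)
From HB Require Import structures.
From mathcomp Require Import all_boot all_algebra.
From mathcomp Require Import finmap.
From mathcomp.multinomials Require Import monalg.

Set Implicit Arguments.
Unset Strict Implicit.
Unset Printing Implicit Defensive.

Import GRing.Theory.
Local Open Scope fset_scope.
Local Open Scope ring_scope.

Record quiver := Quiver {
  vertex : finType;
  arrow : finType;
  src : arrow -> vertex;
  tgt : arrow -> vertex }.

Definition adjacent (Q : quiver) : rel (vertex Q) :=
  fun x y => [exists a : arrow Q,
    ((src a == x) && (tgt a == y)) || ((src a == y) && (tgt a == x))].

Definition connected (Q : quiver) : Prop :=
  (0 < #|vertex Q|)%N /\ forall x y : vertex Q, connect (@adjacent Q) x y.

(* A path is stored as its target together with its arrows in the order in
   which they are written: the path a_n ... a_1, which runs through a_1 first,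
   has word [:: a_n; ...; a_1].  The target is needed for trivial paths. *)
Fixpoint path_wf (Q : quiver) (v : vertex Q) (w : seq (arrow Q)) : bool :=
  if w is a :: w' then (tgt a == v) && path_wf (src a) w' else true.

Record qpath (Q : quiver) := QPath {
  qpath_val : vertex Q * seq (arrow Q);
  _ : path_wf qpath_val.1 qpath_val.2 }.

HB.instance Definition _ (Q : quiver) := [isSub for @qpath_val Q].
HB.instance Definition _ (Q : quiver) := [Choice of qpath Q by <:].

Definition ptgt (Q : quiver) (p : qpath Q) : vertex Q := (val p).1.
Definition pword (Q : quiver) (p : qpath Q) : seq (arrow Q) := (val p).2.
Definition psrc (Q : quiver) (p : qpath Q) : vertex Q :=
  last (ptgt p) (map (@src Q) (pword p)).
Definition plen (Q : quiver) (p : qpath Q) : nat := size (pword p).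

Lemma ptriv_wf (Q : quiver) (v : vertex Q) :
  path_wf (v, [::] : seq (arrow Q)).1 (v, [::] : seq (arrow Q)).2.
Proof. by []. Qed.
Definition ptriv (Q : quiver) (v : vertex Q) : qpath Q := QPath (ptriv_wf v).

Lemma parr_wf (Q : quiver) (a : arrow Q) :
  path_wf (tgt a, [:: a]).1 (tgt a, [:: a]).2.
Proof. by rewrite /= eqxx. Qed.
Definition parr (Q : quiver) (a : arrow Q) : qpath Q := QPath (parr_wf a).

Lemma path_wf_cat (Q : quiver) (v : vertex Q) (w1 w2 : seq (arrow Q)) :
  path_wf v (w1 ++ w2) =
  path_wf v w1 && path_wf (last v (map (@src Q) w1)) w2.
Proof. by elim: w1 v => //= a w1 IH v; rewrite IH andbA. Qed.

Lemma qpathP (Q : quiver) (p : qpath Q) : path_wf (ptgt p) (pword p).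
Proof. exact: (valP p). Qed.

(* pcomp p q is the path pq (first q, then p); None when s(p) <> t(q). *)
Definition pcomp (Q : quiver) (p q : qpath Q) : option (qpath Q) :=
  if psrc p == ptgt q then insub (ptgt p, pword p ++ pword q) else None.

Lemma ptake_wf (Q : quiver) (n : nat) (p : qpath Q) :
  path_wf (ptgt p, take n (pword p)).1 (ptgt p, take n (pword p)).2.
Proof.
by have := qpathP p; rewrite -{1}(cat_take_drop n (pword p)) path_wf_cat => /andP[].
Qed.

Lemma pdrop_wf (Q : quiver) (n : nat) (p : qpath Q) :
  let u := (last (ptgt p) (map (@src Q) (take n (pword p))), drop n (pword p)) in
  path_wf u.1 u.2.
Proof.
by have := qpathP p; rewrite -{1}(cat_take_drop n (pword p)) path_wf_cat => /andP[].
Qed.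

(* p = (ptake n p)(pdrop n p), where ptake n p consists of the n leftmost
   (that is, the last n traversed) arrows of p. *)
Definition ptake (Q : quiver) (n : nat) (p : qpath Q) : qpath Q :=
  QPath (ptake_wf n p).
Definition pdrop (Q : quiver) (n : nat) (p : qpath Q) : qpath Q :=
  QPath (pdrop_wf n p).

Lemma pcomp_take_drop (Q : quiver) (n : nat) (p : qpath Q) :
  pcomp (ptake n p) (pdrop n p) = Some p.
Proof.
rewrite /pcomp /psrc /ptgt /pword /= eqxx cat_take_drop.
rewrite (_ : ((val p).1, (val p).2) = val p) ?valK //.
by case: (val p).
Qed.

(* The actions on the dual basis: ldual t p is the path r with t p^* = r^*,
   i.e. p = rt, and rdual p n is the path r with p^* n = r^*, i.e. p = nr;
   None stands for t p^* = 0, resp. p^* n = 0 (see ldualP and rdualP). *)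
Definition ldual (Q : quiver) (t p : qpath Q) : option (qpath Q) :=
  let r := ptake (plen p - plen t)%N p in
  if pcomp r t == Some p then Some r else None.

Definition rdual (Q : quiver) (p n : qpath Q) : option (qpath Q) :=
  let r := pdrop (plen n) p in
  if pcomp n r == Some p then Some r else None.

Lemma pcomp_val (Q : quiver) (p q r : qpath Q) :
  pcomp p q = Some r ->
  [/\ psrc p = ptgt q, ptgt r = ptgt p & pword r = pword p ++ pword q].
Proof.
rewrite /pcomp; case: eqP => // e; case: insubP => // u _ ur [<-].
by rewrite /ptgt /pword ur.
Qed.

Lemma qpath_eq (Q : quiver) (p q : qpath Q) :
  ptgt p = ptgt q -> pword p = pword q -> p = q.
Proof.
rewrite /ptgt /pword => e1 e2; apply: val_inj.
by case: (val p) (val q) e1 e2 => ? ? [? ?] /= -> ->.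
Qed.

Lemma ldualP (Q : quiver) (t p r : qpath Q) :
  ldual t p = Some r <-> pcomp r t = Some p.
Proof.
rewrite /ldual; split; first by case: eqP => // e [<-].
move=> e; have [e1 e2 e3] := pcomp_val e.
suff -> : ptake (plen p - plen t) p = r by rewrite e eqxx.
by apply: qpath_eq; rewrite // /ptake /pword /= -/(pword p) /plen e3 size_cat
  addnK take_size_cat.
Qed.

Lemma rdualP (Q : quiver) (p n r : qpath Q) :
  rdual p n = Some r <-> pcomp n r = Some p.
Proof.
rewrite /rdual; split; first by case: eqP => // e [<-].
move=> e; have [e1 e2 e3] := pcomp_val e.
have e4 : last (ptgt p) (map (@src Q) (take (plen n) (pword p))) = psrc n.
  by rewrite e3 /plen take_size_cat // e2.
suff -> : pdrop (plen n) p = r by rewrite e eqxx.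
apply: qpath_eq; first by rewrite -e1 -e4.
by rewrite /pdrop {1}/pword /= -/(pword p) e3 /plen drop_size_cat.
Qed.

(* The path algebra KQ; products of non-composable paths are 0. *)
Notation path_alg K Q := {malg K[qpath Q]}.

Definition path_mul (K : fieldType) (Q : quiver) (f g : path_alg K Q) :
    path_alg K Q :=
  \sum_(p <- msupp f) \sum_(q <- msupp g)
    (if pcomp p q is Some r then << f@_p * g@_q *g r >> else 0).

Record ideal (K : fieldType) (Q : quiver) (J : path_alg K Q -> Prop) : Prop := {
  ideal0 : J 0;
  idealD : forall f g, J f -> J g -> J (f + g);
  idealZ : forall (c : K) f, J f -> J (c *: f);
  idealMl : forall f g, J g -> J (path_mul f g);
  idealMr : forall f g, J f -> J (path_mul f g) }.

Definition generated_by (K : fieldType) (Q : quiver) (S : {fset qpath Q})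
    (I : path_alg K Q -> Prop) : Prop :=
  forall f, I f <->
    forall J : path_alg K Q -> Prop,
      ideal J -> (forall p, p \in S -> J << p >>) -> J f.

Definition quadratic_generators (K : fieldType) (Q : quiver)
    (I : path_alg K Q -> Prop) (S : {fset qpath Q}) : Prop :=
  (forall p, p \in S -> plen p = 2%N) /\ generated_by S I.

Definition minimal_quadratic_generators (K : fieldType) (Q : quiver)
    (I : path_alg K Q -> Prop) (R : {fset qpath Q}) : Prop :=
  quadratic_generators I R /\
  forall S : {fset qpath Q}, quadratic_generators I S -> S `<=` R -> S = R.

Definition finite_dim_quotient (K : fieldType) (Q : quiver)
    (I : path_alg K Q -> Prop) : Prop :=
  exists s : seq (path_alg K Q), forall f,
    exists c : nat -> K, I (f - \sum_(i < size s) c i *: s`_i).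

(* The product of two arrows a, b in KQ; it is the path ab if s(a) = t(b). *)
Definition arr_mul (K : fieldType) (Q : quiver) (a b : arrow Q) : path_alg K Q :=
  path_mul << parr a >> << parr b >>.

Record gentle (K : fieldType) (Q : quiver) (I : path_alg K Q -> Prop) : Prop := {
  gentle_connected : connected Q;
  gentle_fd : finite_dim_quotient I;
  gentle_in : forall v : vertex Q, (#|[set a : arrow Q | tgt a == v]| <= 2)%N;
  gentle_out : forall v : vertex Q, (#|[set a : arrow Q | src a == v]| <= 2)%N;
  gentle_nonrel_l : forall a b b' : arrow Q,
    src a = tgt b -> ~ I (arr_mul K a b) ->
    src a = tgt b' -> ~ I (arr_mul K a b') -> b = b';
  gentle_nonrel_r : forall a c c' : arrow Q,
    src c = tgt a -> ~ I (arr_mul K c a) ->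
    src c' = tgt a -> ~ I (arr_mul K c' a) -> c = c';
  gentle_rel_l : forall a b b' : arrow Q,
    src a = tgt b -> I (arr_mul K a b) ->
    src a = tgt b' -> I (arr_mul K a b') -> b = b';
  gentle_rel_r : forall a c c' : arrow Q,
    src c = tgt a -> I (arr_mul K c a) ->
    src c' = tgt a -> I (arr_mul K c' a) -> c = c';
  gentle_quadratic : exists S : {fset qpath Q}, quadratic_generators I S }.

Definition pathQ0 (Q : quiver) : pred (qpath Q) := fun p => plen p == 0%N.
Definition pathQ1 (Q : quiver) : pred (qpath Q) := fun p => plen p == 1%N.
Definition pathR (Q : quiver) (R : {fset qpath Q}) : pred (qpath Q) :=
  fun p => p \in R.

(* Elements of R are nontrivial, hence determined by their words. *)
Definition pathB (Q : quiver) (R : {fset qpath Q}) : pred (qpath Q) :=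
  fun p => all (fun r => ~~ infix (pword r) (pword p)) R.

Definition cyclic_pair (Q : quiver) (p q : qpath Q) : bool :=
  (psrc p == ptgt q) && (ptgt p == psrc q).

(* The pair (p, q^* ) is represented by (p, q). *)
Definition odot (Q : quiver) (X Y : pred (qpath Q)) : choiceType :=
  {u : qpath Q * qpath Q | [&& X u.1, Y u.2 & cyclic_pair u.1 u.2]}.

(* chi(x^* )(q, x^* ) in K(X (.) Y^* ), where x = None stands for x^* = 0. *)
Definition odot_term (K : fieldType) (Q : quiver) (X Y : pred (qpath Q))
    (q : qpath Q) (x : option (qpath Q)) : {malg K[odot X Y]} :=
  if obind (fun r => insub (q, r) : option (odot X Y)) x is Some u
  then << u >> else 0.

Definition lin_ext (K : fieldType) (T : choiceType) (V : lmodType K)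
    (h : T -> V) (f : {malg K[T]}) : V :=
  \sum_(u <- msupp f) f@_u *: h u.

Definition d0 (K : fieldType) (Q : quiver) (R : {fset qpath Q}) :
    {malg K[odot (@pathQ0 Q) (pathB R)]} -> {malg K[odot (@pathQ1 Q) (pathB R)]} :=
  lin_ext (fun u => let: (e, p) := val u in
    \sum_(a : arrow Q | ptriv (src a) == e)
       odot_term K (@pathQ1 Q) (pathB R) (parr a) (ldual (parr a) p)
    - \sum_(a : arrow Q | ptriv (tgt a) == e)
       odot_term K (@pathQ1 Q) (pathB R) (parr a) (rdual p (parr a))).

(* The factorisations q = t a n with a an arrow are indexed by the position i
   of a in q: then t = ptake i q and n = pdrop i.+1 q. *)
Definition d1 (K : fieldType) (Q : quiver) (R : {fset qpath Q}) :
    {malg K[odot (@pathQ1 Q) (pathB R)]} -> {malg K[odot (pathR R) (pathB R)]} :=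
  lin_ext (fun u => let: (a, p) := val u in
    \sum_(q <- R) \sum_(i < plen q | pdrop i (ptake i.+1 q) == a)
       odot_term K (pathR R) (pathB R) q
         (obind (fun r => rdual r (pdrop i.+1 q)) (ldual (ptake i q) p))).

(* The elements of S lie in Ker g, and their classes form a basis of
   Ker g / Im f; in particular distinct elements have distinct classes. *)
Definition classes_form_basis (K : fieldType) (U V W : lmodType K)
    (f : U -> V) (g : V -> W) (S : V -> Prop) : Prop :=
  [/\ forall x, S x -> g x = 0,
      forall (s : seq V) (c : V -> K),
        uniq s -> (forall x, x \in s -> S x) ->
        (exists y, \sum_(x <- s) c x *: x = f y) ->
        forall x, x \in s -> c x = 0
    & forall z, g z = 0 ->
        exists (s : seq V) (c : V -> K) (y : U),
          (forall x, x \in s -> S x) /\ z = \sum_(x <- s) c x *: x + f y].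

(* o selects one of (a, b) and (b, a) for each pair of distinct arrows. *)
Definition orientation (Q : quiver) (o : rel (arrow Q)) : Prop :=
  forall a b, a != b -> o a b = ~~ o b a.

Inductive HH1_dual_basis_elt (K : fieldType) (Q : quiver)
    (I : path_alg K Q -> Prop) (R : {fset qpath Q}) (o : rel (arrow Q)) :
    {malg K[odot (@pathQ1 Q) (pathB R)]} -> Prop :=
| HH1_dual_pair (a b : arrow Q) (u v : odot (@pathQ1 Q) (pathB R)) :
    val u = (parr a, parr b) -> val v = (parr b, parr a) ->
    a != b -> o a b -> I (arr_mul K a b) -> I (arr_mul K b a) ->
    HH1_dual_basis_elt I o (<< u >> - << v >>)
| HH1_dual_loop (a : arrow Q) (e : vertex Q) (u : odot (@pathQ1 Q) (pathB R)) :
    val u = (parr a, ptriv e) ->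
    HH1_dual_basis_elt I o << u >>
| HH1_dual_char2 (a : arrow Q) (u : odot (@pathQ1 Q) (pathB R)) :
    2%N \in [pchar K] -> val u = (parr a, parr a) ->
    HH1_dual_basis_elt I o << u >>.

(* Main.v *)
Require Import Defs.
From mathcomp Require Import all_boot all_algebra.
From mathcomp Require Import finmap.
From mathcomp.multinomials Require Import monalg.

(** Why the theorem holds.  A pair (a, p^* ) with a an arrow is the cyclic word
    a p with a marked letter, and the complex splits along cyclic words.
    Since p contains no relation, every relation met around the cycle a p
    involves the marked letter.

    Let h send (a, p^* ) to (s(a), (pa)^* ), or to 0 when pa contains a
    relation; it moves the mark across one letter.  Write Z(a, v) for the
    coefficient of a cocycle z at the arrow a and the path with word v.  For
    v = v' b, the coefficient of d0 (h z) at (a, v) is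
       [va has no relation] Z(a, v) - [av has no relation] Z(b, a v'),
    and the cocycle condition at the relation ba says Z(a, v' b) = - Z(b, a v').
    Among the two brackets:
    - both are nonzero only if the cycle a v meets no relation at all; its
      powers would then be infinitely many basis paths of the finite
      dimensional algebra A (no_nonrel_cycle);
    - if exactly one is nonzero, the coefficient is Z(a, v), directly or by the
      cocycle condition;
    - if both vanish and v has length at least two, the cocycle condition gives
      Z(a, v) = - Z(b, a v') = 0, since a v' contains a relation.
    So z - d0 (h z) lives on the pairs (a, e^* ) and (a, b^* ) with ab and ba in
    I (d0_rotate).  There the cocycle condition reads Z(a, b) = - Z(b, a), which
    for a = b leaves (a, a^* ) only in characteristic 2; hence the listed
    elements span (reduced_in_span).

    They are independent modulo Im d0 because d0 has coefficient 0 at all these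
    short pairs (d0_reduced) and each listed element has a pair at which it
    alone is nonzero (basis_elt_pivot). *)

Set Implicit Arguments.
Unset Strict Implicit.
Unset Printing Implicit Defensive.

Import GRing.Theory.

(** * Linear extensions *)

Section LinearExtension.
Local Open Scope ring_scope.

Variables (K : fieldType) (T : choiceType).
Implicit Types f g : {malg K[T]}.

Lemma mcoeff_sum (J : Type) (s : seq J) (P : pred J) (F : J -> {malg K[T]}) u :
  (\sum_(j <- s | P j) F j)@_u = \sum_(j <- s | P j) (F j)@_u.
Proof. exact: raddf_sum. Qed.

Lemma mcoeffUB u t k :
  (<< u >> - << t >> : {malg K[T]})@_k = (u == k)%:R - (t == k)%:R.
Proof. by rewrite mcoeffB [X in X - _]mcoeffU [X in _ - X]mcoeffU. Qed.

(** The scalar companion of lin_ext: by mcoeff_lin_ext, every coefficient of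
    d0, d1 and of the homotopy is such a form, so identities between them reduce
    to identities on pairs of paths. *)
Definition lin_form (h : T -> K) f : K := \sum_(u <- msupp f) f@_u * h u.

Lemma mcoeff_lin_ext (T' : choiceType) (h : T -> {malg K[T']}) f (w : T') :
  (lin_ext h f)@_w = lin_form (fun u => (h u)@_w) f.
Proof.
by rewrite /lin_ext raddf_sum; apply: eq_bigr => u _; rewrite /= mcoeffZ.
Qed.

Lemma lin_formEw h f (d : {fset T}) :
  (msupp f `<=` d)%fset -> lin_form h f = \sum_(u <- d) f@_u * h u.
Proof.
move=> sub; rewrite /lin_form (big_fset_incl _ sub) // => u _ uNf.
by rewrite mcoeff_outdom // mul0r.
Qed.

Lemma lin_formB h f g : lin_form h (f - g) = lin_form h f - lin_form h g.
Proof.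
rewrite (@lin_formEw h f (msupp f `|` msupp g)%fset) ?fsubsetUl //.
rewrite (@lin_formEw h g (msupp f `|` msupp g)%fset) ?fsubsetUr //.
rewrite (@lin_formEw h (f - g) (msupp f `|` msupp g)%fset) ?msuppB_le //.
by rewrite -sumrB; apply: eq_bigr => u _; rewrite mcoeffB mulrBl.
Qed.

Lemma lin_formU h u : lin_form h << u >> = h u.
Proof.
by rewrite /lin_form msuppU oner_eq0 big_seq_fset1 mcoeffUU mul1r.
Qed.

Lemma lin_form_addf h h' f :
  lin_form (fun u => h u + h' u) f = lin_form h f + lin_form h' f.
Proof.
by rewrite /lin_form -big_split; apply: eq_bigr => u _; rewrite mulrDr.
Qed.

Lemma lin_form_subf h h' f :
  lin_form (fun u => h u - h' u) f = lin_form h f - lin_form h' f.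
Proof.
by rewrite /lin_form -sumrB; apply: eq_bigr => u _; rewrite mulrBr.
Qed.

Lemma eq_lin_form h h' f : h =1 h' -> lin_form h f = lin_form h' f.
Proof. by move=> e; apply: eq_bigr => u _; rewrite e. Qed.

Lemma lin_form_indicator (P : pred T) f u :
  P u -> (forall v, P v -> v = u) -> lin_form (fun v => (P v)%:R) f = f@_u.
Proof.
move=> Pu Puniq.
rewrite (@lin_formEw _ f (u |` msupp f)%fset) ?fsubsetU1 //.
rewrite (bigD1_seq u) ?fset_uniq ?in_fset1U ?eqxx //= Pu mulr1.
rewrite big1 ?addr0 // => v vu.
case: (boolP (P v)) => [/Puniq e|_]; last by rewrite mulr0.
by rewrite e eqxx in vu.
Qed.

Lemma lin_form_pred0 (P : pred T) f :
  P =1 pred0 -> lin_form (fun v => (P v)%:R) f = 0.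
Proof. by move=> P0; apply: big1 => u _; rewrite P0 mulr0. Qed.

End LinearExtension.

(** * Paths and their words *)

Section Words.

Variable Q : quiver.
Implicit Types (p q r : qpath Q) (a b : arrow Q) (s v w : seq (arrow Q)).

(** A nontrivial word determines the target of the path. *)
Lemma pword_inj p q : pword p = pword q -> pword p <> [::] -> p = q.
Proof.
move=> e ne; apply: qpath_eq => //.
move: (qpathP p) (qpathP q) e ne; case: (pword p) => // a w /= /andP[/eqP<- _].
by move=> + e; rewrite -e => /= /andP[/eqP<- _].
Qed.

Lemma pword_arr p a : pword p = [:: a] -> p = parr a.
Proof. by move=> e; apply: pword_inj; rewrite ?e. Qed.

Lemma pword_triv p : pword p = [::] -> p = ptriv (ptgt p).
Proof. by move=> e; apply: qpath_eq. Qed.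

Lemma qpath_of_word x w :
  path_wf x w -> exists2 p, ptgt p = x & pword p = w.
Proof. by move=> xw; exists (@QPath Q (x, w) xw). Qed.

Lemma pcompP p q r :
  Defs.pcomp p q = Some r <->
  [/\ psrc p = ptgt q, ptgt r = ptgt p & pword r = pword p ++ pword q].
Proof.
split=> [|[e1 e2 e3]]; first exact: pcomp_val.
rewrite /Defs.pcomp e1 eqxx insubT /=.
  by rewrite path_wf_cat qpathP /= -/(psrc p) e1 qpathP.
by move=> pf; congr Some; apply: qpath_eq; rewrite ?e2 ?e3.
Qed.

(** The words of closed paths.  The base point is left out because rotating
    the word changes it. *)
Definition closedw s : Prop :=
  exists x, path_wf x s /\ last x (map (@src Q) s) = x.

Lemma closedw_rot s1 s2 : closedw (s1 ++ s2) -> closedw (s2 ++ s1).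
Proof.
case=> x []; rewrite path_wf_cat map_cat last_cat => /andP[wf1 wf2] e.
exists (last x (map (@src Q) s1)).
by rewrite path_wf_cat map_cat last_cat e wf1 wf2.
Qed.

Lemma closedw_power s n : closedw s ->
  exists p, pword p = flatten (nseq n s).
Proof.
case=> x [wf e].
suff [/qpath_of_word[p _ pw] _] : path_wf x (flatten (nseq n s)) /\
    last x (map (@src Q) (flatten (nseq n s))) = x by exists p.
elim: n => //= n [IH1 IH2].
by rewrite path_wf_cat map_cat last_cat e wf.
Qed.

(** * Bases of pairs, indexed by pairs of words *)

Section Odot.
Variables X Y : pred (qpath Q).
Implicit Types u t : odot X Y.

Definition odot_words u := (pword (val u).1, pword (val u).2).

Lemma odot_cyclic u :
  psrc (val u).1 = ptgt (val u).2 /\ ptgt (val u).1 = psrc (val u).2.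
Proof. by case/and3P: (valP u) => _ _ /andP[/eqP -> /eqP]. Qed.

(** The two endpoints of one path of a cyclic pair are those of the other, so
    one nontrivial word already fixes both paths. *)
Lemma odot_words_inj u t :
  odot_words u = odot_words t -> (odot_words u).1 ++ (odot_words u).2 <> [::] ->
  u = t.
Proof.
case=> e1 e2 ne; apply: val_inj.
have [c1 c2] := odot_cyclic u; have [c3 c4] := odot_cyclic t.
suff [] : (val u).1 = (val t).1 /\ (val u).2 = (val t).2.
  by case: (val u) (val t) => ? ? [? ?] /= -> ->.
move: ne; rewrite /odot_words /=; case e: (pword (val u).1) => [|a w] /= ne.
  have E := pword_inj e2 ne; split=> //.
  by apply: qpath_eq; rewrite // c2 c4 E.
have E : (val u).1 = (val t).1 by apply: pword_inj; rewrite // e.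
by split=> //; apply: qpath_eq; rewrite // -c1 -c3 E.
Qed.

Lemma odot_closedw u : closedw ((odot_words u).1 ++ (odot_words u).2).
Proof.
have [c1 c2] := odot_cyclic u.
exists (ptgt (val u).1); rewrite path_wf_cat map_cat last_cat qpathP /=.
by rewrite -/(psrc (val u).1) c1 qpathP -/(psrc (val u).2).
Qed.

(** Pairs of paths of a cyclic pair are exactly the ways to cut a closed word
    in two; this direction produces the pairs at which equations between
    coefficients are read. *)
Lemma closedw_odot s w : closedw (s ++ w) ->
  (forall p, pword p = s -> X p) -> (forall p, pword p = w -> Y p) ->
  exists u, odot_words u = (s, w).
Proof.
case=> x []; rewrite path_wf_cat map_cat last_cat => /andP[wf1 wf2] e hX hY.
have [p px pw] := qpath_of_word wf1; have [q qx qw] := qpath_of_word wf2.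
have pf : [&& X (p, q).1, Y (p, q).2 & cyclic_pair (p, q).1 (p, q).2].
  rewrite hX // hY // /cyclic_pair /=.
  by rewrite /psrc pw qw px qx eqxx e eqxx.
by exists (Sub (p, q) pf); rewrite /odot_words SubK /= pw qw.
Qed.

Variable K : fieldType.
Local Open Scope ring_scope.
Implicit Types f g : {malg K[odot X Y]}.

(** The coefficient of f at the pair with words s and w, and 0 if there is no
    such pair.  This absorbs the function chi: a path that contains a relation,
    or two paths that are not composable, simply have coefficient 0.  Two empty
    words do not determine a pair, whence the side condition of wcoeff_odot. *)
Definition wcoeff f s w : K :=
  lin_form (fun u => (odot_words u == (s, w))%:R) f.

Lemma wcoeff_odot f u s w :
  odot_words u = (s, w) -> s ++ w <> [::] -> wcoeff f s w = f@_u.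
Proof.
move=> e ne; apply: lin_form_indicator; first exact/eqP.
by move=> t /eqP et; apply: odot_words_inj; rewrite et /= ?e.
Qed.

Lemma wcoeff_none f s w :
  (forall u, odot_words u <> (s, w)) -> wcoeff f s w = 0.
Proof. by move=> ne; apply: lin_form_pred0 => u; apply/negbTE/eqP. Qed.

Lemma wcoeff_neq0 f s w : wcoeff f s w != 0 -> exists u, odot_words u = (s, w).
Proof.
case: (boolP (has (fun u => odot_words u == (s, w)) (msupp f))).
  by case/hasP=> u _ /eqP; exists u.
move=> /hasPn none; rewrite /wcoeff /lin_form big_seq big1 ?eqxx // => u.
by move=> /none /negbTE->; rewrite mulr0.
Qed.

Lemma wcoeffB f g s w : wcoeff (f - g) s w = wcoeff f s w - wcoeff g s w.
Proof. exact: lin_formB. Qed.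

Lemma wcoeffU u s w : wcoeff << u >> s w = (odot_words u == (s, w))%:R.
Proof. exact: lin_formU. Qed.

Lemma wcoeffUB u t s w :
  wcoeff (<< u >> - << t >>) s w =
    (odot_words u == (s, w))%:R - (odot_words t == (s, w))%:R.
Proof. by rewrite wcoeffB [X in X - _]wcoeffU [X in _ - X]wcoeffU. Qed.

Lemma mcoeff_odot_term q x u :
  (odot_term K X Y q x)@_u = ((val u).1 == q)%:R * (x == Some (val u).2)%:R.
Proof.
rewrite /odot_term; case: x => [r|] /=; last by rewrite mcoeff0 mulr0.
case: insubP => [t pf et|npf].
  rewrite mcoeffU -natrM mulnb -(inj_eq val_inj) et.
  by rewrite [val u]surjective_pairing xpair_eqE /= [q == _]eq_sym.
rewrite mcoeff0 -natrM mulnb.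
case: andP => // -[/eqP e1 /eqP [e2]]; case/negP: npf.
by rewrite /= -e1 e2; exact: (valP u).
Qed.

Lemma odot_termE u : odot_term K X Y (val u).1 (Some (val u).2) = << u >>.
Proof.
rewrite /odot_term /=; case: insubP => [t _ et|/negP[]]; last exact: (valP u).
by congr << _ >>; apply: val_inj; rewrite et [RHS]surjective_pairing.
Qed.

End Odot.
End Words.

(** * The differentials and the contracting homotopy in coordinates *)

Section Coordinates.
Local Open Scope ring_scope.

Variable Q : quiver.
Implicit Types (p q r : qpath Q) (a b : arrow Q) (s v w : seq (arrow Q)).

Lemma pword_ptake n q : pword (ptake n q) = take n (pword q).
Proof. by []. Qed.

Lemma pword_pdrop n q : pword (pdrop n q) = drop n (pword q).
Proof. by []. Qed.

Lemma ptgt_pdrop n q :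
  ptgt (pdrop n q) = last (ptgt q) (map (@src Q) (take n (pword q))).
Proof. by []. Qed.

Lemma psrc_pdrop n q : psrc (pdrop n q) = psrc q.
Proof.
by rewrite {2}/psrc -(cat_take_drop n (pword q)) map_cat last_cat.
Qed.

Lemma psrc_pcomp p q r : Defs.pcomp p q = Some r -> psrc r = psrc q.
Proof.
by case/pcompP=> e1 e2 e3; rewrite /psrc e2 e3 map_cat last_cat -/(psrc p) e1.
Qed.

Lemma ldual_rdualP t p n r :
  obind (fun r' => rdual r' n) (ldual t p) = Some r <->
  [/\ psrc n = ptgt r, psrc r = ptgt t, ptgt p = ptgt n &
      pword p = pword n ++ pword r ++ pword t].
Proof.
split=> [|[e1 e2 e3 e4]].
  case e: (ldual t p) => [m|] //= /rdualP nr.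
  move/ldualP/pcompP: e => [e1 -> ->].
  by rewrite -(psrc_pcomp nr) e1; case/pcompP: nr => -> -> ->; rewrite catA.
have [m nr] : exists m, Defs.pcomp n r = Some m.
  rewrite /Defs.pcomp e1 eqxx; case: insubP => [m _ _|]; first by exists m.
  by rewrite path_wf_cat qpathP -/(psrc n) e1 qpathP.
have -> : ldual t p = Some m.
  apply/ldualP/pcompP; rewrite (psrc_pcomp nr).
  by case/pcompP: nr => _ -> ->; rewrite e4 catA.
by apply/rdualP.
Qed.

Lemma odot_arrow (Y : pred (qpath Q)) (u : odot (@pathQ1 Q) Y) :
  exists a, (val u).1 = parr a.
Proof.
case/and3P: (valP u); rewrite /pathQ1 /plen => len1 _ _.
case e: (pword (val u).1) len1 => [|a []] // _.
by exists a; apply: pword_arr.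
Qed.

Lemma parr_inj : injective (@parr Q).
Proof. by move=> a b /(congr1 (@pword Q))[]. Qed.

Variables (K : fieldType) (R : {fset qpath Q}).
Hypothesis R_quadratic : forall p, p \in R -> plen p = 2%N.

Notation C0 := (odot (@pathQ0 Q) (pathB R)).
Notation C1 := (odot (@pathQ1 Q) (pathB R)).
Notation C2 := (odot (pathR R) (pathB R)).

(** The transpose of d1: a relation ba with a path of word v is reached from
    the arrow a, via b p^*, and from the arrow b, via p^* a. *)
Lemma d1_coeff (f : {malg K[C1]}) (w : C2) a b v :
  odot_words w = ([:: b; a], v) ->
  (d1 f)@_w = wcoeff f [:: a] (v ++ [:: b]) + wcoeff f [:: b] (a :: v).
Proof.
move=> ew; rewrite /d1 mcoeff_lin_ext -lin_form_addf; apply: eq_lin_form => u.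
rewrite [val u]surjective_pairing raddf_sum.
have [c1 c2] := odot_cyclic w; have [c3 c4] := odot_cyclic u.
have [x ux] := odot_arrow u.
move: ew; rewrite /odot_words => -[eq0 er0].
have q0R : (val w).1 \in R by case/and3P: (valP w).
rewrite (bigD1_seq (val w).1) ?fset_uniq //= [X in _ + X]big1 ?addr0;
  last first.
  move=> q qw; rewrite raddf_sum big1 // => i _.
  by rewrite /= mcoeff_odot_term eq_sym (negbTE qw) mul0r.
set q0 := (val w).1 in q0R c1 c2 eq0 *; set r0 := (val w).2 in c1 c2 er0 *.
set p := (val u).2 in c3 c4 *.
rewrite -(big_mkord (fun i => pdrop i (ptake i.+1 q0) == (val u).1)
  (fun i => odot_term K (pathR R) (pathB R) q0
    (obind (fun r => rdual r (pdrop i.+1 q0)) (ldual (ptake i q0) p)))).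
(* The relation ba has two factorisations: b marked with nothing on its left
   (i = 0), and a marked with b on its left (i = 1). *)
rewrite R_quadratic // big_mkcond /index_iota /= !big_cons big_nil addr0.
rewrite mcoeffD addrC.
have src_q0 : psrc q0 = src a by rewrite /psrc eq0.
have -> : pdrop 0 (ptake 1 q0) = parr b.
  by apply: pword_arr; rewrite pword_pdrop pword_ptake eq0.
have -> : pdrop 1 (ptake 2 q0) = parr a.
  by apply: pword_arr; rewrite pword_pdrop pword_ptake eq0.
have nat_case (B1 B2 : bool) (x1 : option (qpath Q)) :
    (B1 && (x1 == Some r0)) = B2 ->
    (if B1 then odot_term K (pathR R) (pathB R) q0 x1 else 0)@_w = B2%:R.
  move=> <-; case: ifP => _; last by rewrite mcoeff0.
  by rewrite mcoeff_odot_term eqxx mul1r.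
rewrite ux; congr (_ + _); apply: nat_case;
  rewrite xpair_eqE eqseq_cons andbT (inj_eq parr_inj) eq_sym;
  case: eqP => //= ex; apply/eqP/eqP;
  rewrite ldual_rdualP psrc_pdrop ptgt_pdrop pword_pdrop pword_ptake eq0 /=
    er0 ?cats0.
all: by [move=> [_ _ _ ->] | move=> ep; split; rewrite // -c3 ux ex].
Qed.

(** The transpose of d0: (a, v) is reached from the closed path va with the
    sign +, and from av with the sign -. *)
Lemma d0_coeff (f : {malg K[C0]}) (w : C1) a v :
  odot_words w = ([:: a], v) ->
  (d0 f)@_w = wcoeff f [::] (v ++ [:: a]) - wcoeff f [::] (a :: v).
Proof.
move=> ew; rewrite /d0 mcoeff_lin_ext -lin_form_subf; apply: eq_lin_form => u.
rewrite [val u]surjective_pairing mcoeffB !raddf_sum /=.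
have [c1 c2] := odot_cyclic w; have [c3 c4] := odot_cyclic u.
have [x wx] := odot_arrow w; move: ew; rewrite /odot_words wx => -[ex er].
rewrite {x}ex in wx.
set r := (val w).2 in c1 c2 er *; set p := (val u).2 in c3 c4 *.
have ue : (val u).1 = ptriv (ptgt (val u).1).
  by apply: pword_triv; apply: size0nil; case/and3P: (valP u) => /eqP.
rewrite wx in c1 c2.
have sum_case (P : pred (arrow Q)) (x : arrow Q -> option (qpath Q))
    (c : bool) : P a && (x a == Some r) = c ->
    \sum_(i | P i) (odot_term K (@pathQ1 Q) (pathB R) (parr i) (x i))@_w = c%:R.
  move=> <-; rewrite big_mkcond (bigD1 a) //= [X in _ + X]big1 ?addr0.
    by case: (P a); rewrite // mcoeff_odot_term wx eqxx mul1r.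
  move=> i ia; case: (P i); rewrite // mcoeff_odot_term wx.
  by rewrite (inj_eq parr_inj) eq_sym (negbTE ia) mul0r.
have triv_case y : (ptriv y == (val u).1) = (y == ptgt (val u).1).
  rewrite ue; apply/eqP/eqP => [/(congr1 (@ptgt Q)) //|-> //].
have -> : pword (val u).1 = [::] by rewrite ue.
rewrite sumrN; congr (_ - _); apply: sum_case;
  rewrite xpair_eqE eqxx /= triv_case c4.
  apply/andP/eqP => [[_ /eqP/ldualP/pcompP[_ _ ->]]|ep]; first by rewrite er.
  have [p' p'E] : exists p', Defs.pcomp r (parr a) = Some p'.
    rewrite /Defs.pcomp -c2 eqxx; case: insubP => [m _ _|]; first by exists m.
    by rewrite path_wf_cat qpathP -/(psrc r) -c2 qpathP.
  have -> : p = p'.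
    apply: pword_inj; last by rewrite ep; case: (v).
    by case/pcompP: p'E => _ _ ->; rewrite ep er.
  by rewrite (psrc_pcomp p'E) eqxx; split=> //; apply/eqP/ldualP.
apply/andP/eqP => [[_ /eqP/rdualP/pcompP[_ _ ->]]|ep]; first by rewrite /= er.
have [p' p'E] : exists p', Defs.pcomp (parr a) r = Some p'.
  rewrite /Defs.pcomp c1 eqxx; case: insubP => [m _ _|]; first by exists m.
  by rewrite path_wf_cat qpathP -/(psrc (parr a)) c1 qpathP.
have -> : p = p'.
  apply: pword_inj; last by rewrite ep.
  by case/pcompP: p'E => _ _ ->; rewrite ep er.
by rewrite (psrc_pcomp p'E) -c2 eqxx; split=> //; apply/eqP/rdualP.
Qed.

(** The homotopy h of the introduction: the marked arrow a joins p on the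
    right, (a, p^* ) |-> (s(a), (pa)^* ). *)
Definition rotate : {malg K[C1]} -> {malg K[C0]} :=
  lin_ext (fun u => odot_term K (@pathQ0 Q) (pathB R)
    (ptriv (psrc (val u).1)) (Defs.pcomp (val u).2 (val u).1)).

Lemma rotate_coeff (f : {malg K[C1]}) (t : C0) a v :
  odot_words t = ([::], v ++ [:: a]) -> (rotate f)@_t = wcoeff f [:: a] v.
Proof.
move=> et; rewrite /rotate mcoeff_lin_ext; apply: eq_lin_form => u.
rewrite mcoeff_odot_term -natrM mulnb; congr (_%:R); congr nat_of_bool.
have [c1 c2] := odot_cyclic t; have [c3 c4] := odot_cyclic u.
have [x ux] := odot_arrow u; move: et; rewrite /odot_words ux => -[et ew].
rewrite ux in c3 c4 *; rewrite xpair_eqE eqseq_cons andbT /=.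
apply/andP/andP => [[_ /eqP/pcompP[_ _]]|[/eqP ex /eqP ep]].
  by rewrite ew !cats1 => /rcons_inj[-> ->].
have [p' p'E] : exists p', Defs.pcomp (val u).2 (parr x) = Some p'.
  rewrite /Defs.pcomp -c4 eqxx; case: insubP => [m _ _|]; first by exists m.
  by rewrite path_wf_cat qpathP -/(psrc (val u).2) -c4 qpathP.
have tp : (val t).2 = p'.
  apply: pword_inj; last by rewrite ew; case: (v).
  by case/pcompP: p'E => _ _ ->; rewrite ew ep ex.
rewrite p'E tp eqxx; split=> //; rewrite (pword_triv et) c2 tp.
by rewrite (psrc_pcomp p'E).
Qed.

End Coordinates.

(** * Quadratic monomial ideals *)

Lemma sorted_infix (T : eqType) (e : rel T) (w : seq T) :
  reflect (forall b a, infix [:: b; a] w -> e b a) (sorted e w).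
Proof.
apply: (iffP idP) => [ew b a /infixP[s1 [s2 ws]]|].
  by move: ew; rewrite ws sorted_cat_cons /= => /andP[_ /andP[]].
elim: w => // c [|d w] // IH he; apply/andP; split.
  by apply: he; apply/infixP; exists [::], w.
apply: IH => b a /infixP[s1 [s2 ws]].
by apply: he; apply/infixP; exists (c :: s1), s2; rewrite ws.
Qed.

Section Quadratic.

Variables (Q : quiver) (R : {fset qpath Q}).
Hypothesis R_quadratic : forall p, p \in R -> plen p = 2%N.
Implicit Types (p q r : qpath Q) (a b : arrow Q) (s v w : seq (arrow Q)).

(** Relations are encoded through their complement, so that the basis paths
    are the sorted words (pathBE) and the cycles that meet no relation are the
    cycles of the same relation on arrows. *)
Definition nonrel : rel (arrow Q) :=
  fun b a => all (fun r => pword r != [:: b; a]) R.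

Lemma pathBE p : pathB R p = sorted nonrel (pword p).
Proof.
apply/allP/sorted_infix => [hR b a ba|hR r rR].
  by apply/allP => r /hR; apply: contra => /eqP->.
apply/negP => /[dup] rp; have := R_quadratic rR; rewrite /plen.
case er: (pword r) => [|b [|a []]] // _ /hR/allP/(_ r rR).
by rewrite er eqxx.
Qed.

Lemma relP b a : ~~ nonrel b a -> exists2 r, r \in R & pword r = [:: b; a].
Proof. by case/allPn=> r rR /negPn/eqP; exists r. Qed.

Lemma rel_pathR p b a : pword p = [:: b; a] -> ~~ nonrel b a -> p \in R.
Proof.
move=> pw /relP[r rR rw].
by rewrite (_ : p = r) //; apply: pword_inj; rewrite pw.
Qed.

Variables (K : fieldType) (I : path_alg K Q -> Prop).
Hypothesis R_gen : generated_by R I.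
Local Open Scope ring_scope.

Lemma path_mul_single (f g : path_alg K Q) p q r :
  msupp f = [fset p]%fset -> msupp g = [fset q]%fset ->
  Defs.pcomp p q = Some r -> path_mul f g = << f@_p * g@_q *g r >>.
Proof. by rewrite /path_mul => -> -> pq; rewrite !big_seq_fset1 pq. Qed.

Lemma arr_mulE p a b :
  pword p = [:: b; a] -> arr_mul K b a = << p >>.
Proof.
move=> pw; have pba : Defs.pcomp (parr b) (parr a) = Some p.
  apply/pcompP; have := qpathP p; rewrite pw /= => /and3P[/eqP e1 /eqP e2 _].
  by split.
have supp1 c : msupp (<< parr c >> : path_alg K Q) = [fset parr c]%fset.
  by rewrite msuppU oner_eq0.
rewrite /arr_mul (path_mul_single (supp1 b) (supp1 a) pba).
by rewrite (mcoeffUU (parr b)) (mcoeffUU (parr a)) mulr1.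
Qed.

(** The elements of KQ supported outside the basis paths form an ideal, which
    contains R: a product of paths is a basis path only if both factors are. *)
Lemma ideal_coeff f p : I f -> pathB R p -> f@_p = 0.
Proof.
move=> If; move: p.
apply: ((R_gen f).1 If (fun g => forall p, pathB R p -> g@_p = 0)); last first.
  move=> q qR p /allP/(_ q qR); rewrite mcoeffU; case: eqP => // ->.
  by rewrite infix_refl.
have subB n q r :
    Defs.pcomp n q = Some r -> pathB R r -> pathB R n && pathB R q.
  rewrite !pathBE => /pcompP[_ _ ->].
  move/sorted_infix => h; apply/andP.
  split; apply/sorted_infix => b a ba; apply: h.
    exact: infix_catr.
  exact: infix_catl.
have prod0 (g h : path_alg K Q) r : pathB R r ->
    (forall n q, Defs.pcomp n q = Some r -> g@_n * h@_q = 0) ->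
    (path_mul g h)@_r = 0.
  move=> Br gh; rewrite /path_mul raddf_sum big1 // => n _.
  rewrite raddf_sum big1 // => q _; case e: (Defs.pcomp n q) => [m|] /=.
    by rewrite mcoeffU; case: eqP => // em; rewrite gh ?mul0rn // -em.
  by rewrite mcoeff0.
split=> [p|g h g0 h0 p Bp|c g g0 p Bp|g h h0 p Bp|g h g0 p Bp].
- by rewrite mcoeff0.
- by rewrite mcoeffD g0 // h0 // addr0.
- by rewrite mcoeffZ g0 // mulr0.
- by apply: prod0 => // n q /subB/(_ Bp)/andP[_ /h0->]; rewrite mulr0.
by apply: prod0 => // n q /subB/(_ Bp)/andP[/g0-> _]; rewrite mul0r.
Qed.

Lemma ideal_arr_mul p b a :
  pword p = [:: b; a] -> I (arr_mul K b a) <-> ~~ nonrel b a.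
Proof.
move=> pw; rewrite (arr_mulE pw); split=> [Ip|/(rel_pathR pw) pR]; last first.
  by apply/R_gen => J _; apply.
apply/negP => nba; have := @ideal_coeff _ p Ip.
rewrite pathBE pw /= nba mcoeffUU => /(_ isT)/eqP.
by rewrite oner_eq0.
Qed.

Hypothesis I_fd : finite_dim_quotient I.

(** A basis path p longer than every path in the supports of a finite
    spanning family would leave coefficient 1 at p in an element of I,
    against ideal_coeff. *)
Lemma pathB_bounded : exists N, forall p, pathB R p -> (plen p < N)%N.
Proof.
have [s span] := I_fd.
exists (\max_(g <- s) \max_(p <- msupp g) plen p).+1 => p Bp.
rewrite ltnS leqNgt; apply/negP => big.
have [c /ideal_coeff/(_ Bp)/eqP] := span << p >>.
rewrite mcoeffB mcoeffUU raddf_sum big1 ?subr0 ?oner_eq0 // => i _.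
rewrite /= mcoeffZ; case: (boolP (p \in msupp s`_i)) => [ps|/mcoeff_outdom->];
  last by rewrite mulr0.
move: big; rewrite ltnNge; case/negP.
rewrite (big_nth 0) big_mkord (bigD1 i) //= (bigD1_seq p) ?fset_uniq //=.
by rewrite leq_max leq_max leqnn.
Qed.

(** Otherwise all powers of the cycle would be basis paths. *)
Lemma no_nonrel_cycle s : s <> [::] -> closedw s -> ~~ cycle nonrel s.
Proof.
case: s => // a w _ cl; apply/negP => cyc.
have [N bound] := pathB_bounded.
have [p pw] := closedw_power N cl.
suff /bound : pathB R p.
  rewrite /plen pw size_flatten /shape map_nseq sumn_nseq mulSn.
  by rewrite ltnNge leq_addr.
have step : path nonrel (last a w) (a :: w).
  by move: cyc; rewrite /= rcons_path andbC.
rewrite pathBE pw; apply: (@path_sorted _ _ (last a w)).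
elim: N {p pw bound} => // n IH.
have -> : flatten (nseq n.+1 (a :: w)) = (a :: w) ++ flatten (nseq n (a :: w)).
  by [].
by rewrite cat_path step.
Qed.

End Quadratic.

(** * Reduction of cocycles *)

Section Reduction.
Local Open Scope ring_scope.

Variables (K : fieldType) (Q : quiver) (R : {fset qpath Q}).
Hypothesis R_quadratic : forall p, p \in R -> plen p = 2%N.
Implicit Types (p q r : qpath Q) (a b c : arrow Q) (s v w : seq (arrow Q)).

Notation C0 := (odot (@pathQ0 Q) (pathB R)).
Notation C1 := (odot (@pathQ1 Q) (pathB R)).
Notation C2 := (odot (pathR R) (pathB R)).
Notation nonrel := (nonrel R).

Lemma odot_sorted (X : pred (qpath Q)) (u : odot X (pathB R)) s w :
  odot_words u = (s, w) -> sorted nonrel w.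
Proof. by case=> _ <-; rewrite -pathBE //; case/and3P: (valP u). Qed.

Lemma wcoeff_not_sorted (X : pred (qpath Q))
    (f : {malg K[odot X (pathB R)]}) s w :
  ~~ sorted nonrel w -> wcoeff f s w = 0.
Proof. by move=> nw; apply: wcoeff_none => u /odot_sorted; apply/negP. Qed.

Lemma wcoeff_rotate (z : {malg K[C1]}) a v :
  closedw (a :: v) ->
  wcoeff (rotate z) [::] (rcons v a) =
    if sorted nonrel (rcons v a) then wcoeff z [:: a] v else 0.
Proof.
rewrite -cats1 => cl; case: ifPn => [Bva|]; last exact: wcoeff_not_sorted.
have [t tE] : exists t : C0, odot_words t = ([::], v ++ [:: a]).
  apply: closedw_odot => [|p pw|p pw]; last by rewrite pathBE // pw.
    exact: (@closedw_rot _ [:: a]).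
  by rewrite /pathQ0 /plen pw.
by rewrite (wcoeff_odot _ tE) ?(rotate_coeff z tE) //; case: (v).
Qed.

(** The coordinate of d1 z at the relation ba and the path with word v; the
    last two hypotheses make it exist. *)
Lemma cocycle_wcoeff (z : {malg K[C1]}) a b v :
  d1 z = 0 -> ~~ nonrel b a -> closedw (a :: rcons v b) -> sorted nonrel v ->
  wcoeff z [:: a] (rcons v b) = - wcoeff z [:: b] (a :: v).
Proof.
move=> dz rba cl Bv.
have [t tE] : exists t : C2, odot_words t = ([:: b; a], v).
  apply: closedw_odot => [|p pw|p pw]; last by rewrite pathBE // pw.
    by apply: (@closedw_rot _ (a :: v) [:: b]); rewrite /= cats1.
  exact: rel_pathR pw rba.
apply/eqP; rewrite -addr_eq0 -cats1 -(d1_coeff R_quadratic z tE) dz.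
by rewrite mcoeff0.
Qed.

(** The pairs that carry cohomology: (a, e^* ), and (a, b^* ) with both ab and
    ba relations. *)
Definition reduced a v : bool :=
  match v with
  | [::] => true
  | [:: b] => ~~ nonrel a b && ~~ nonrel b a
  | _ => false
  end.

(** At (a, e^* ) both terms of d0 come from the same closed path a; at
    (a, b^* ) they would come from ba and ab, which are relations. *)
Lemma d0_reduced (y : {malg K[C0]}) (w : C1) a v :
  odot_words w = ([:: a], v) -> reduced a v -> (d0 y)@_w = 0.
Proof.
move=> ew; rewrite (d0_coeff y ew); case: v {ew} => [|b []] //=.
  by rewrite subrr.
by case/andP=> ab ba; rewrite !wcoeff_not_sorted ?subrr //= ?andbT.
Qed.

Notation gen a p := (odot_term K (@pathQ1 Q) (pathB R) (parr a) (Some p)).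

Lemma mcoeff_gen a p (w : C1) b v :
  odot_words w = ([:: b], v) ->
  (gen a p)@_w = ((a == b) && (p == (val w).2))%:R.
Proof.
case=> /pword_arr eb _; rewrite mcoeff_odot_term eb (inj_eq (@parr_inj Q)).
by rewrite -natrM mulnb eq_sym.
Qed.

Lemma reduced_expansion (g : {malg K[C1]}) :
  (forall a v, ~~ reduced a v -> wcoeff g [:: a] v = 0) ->
  g = \sum_a wcoeff g [:: a] [::] *: gen a (ptriv (src a))
    + \sum_(a : arrow Q) \sum_(b : arrow Q)
        wcoeff g [:: a] [:: b] *: gen a (parr b).
Proof.
move=> g_red; apply/malgP => w.
have [a ea] := odot_arrow w; pose v := pword (val w).2.
have ew : odot_words w = ([:: a], v) by rewrite /odot_words ea.
have sumE (F : arrow Q -> {malg K[C1]}) :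
    (forall b, b != a -> (F b)@_w = 0) -> (\sum_b F b)@_w = (F a)@_w.
  by move=> F0; rewrite mcoeff_sum (bigD1 a) //= big1 ?addr0 // => b /F0.
have off b p (c : K) : b != a -> (c *: gen b p)@_w = 0.
  by move=> ba; rewrite mcoeffZ (mcoeff_gen _ _ ew) (negbTE ba) mulr0.
rewrite mcoeffD 2?sumE => [|b ba|b ba]; last 2 first.
- by rewrite mcoeff_sum big1 // => c _; exact: off.
- exact: off.
rewrite mcoeffZ (mcoeff_gen _ _ ew) eqxx mcoeff_sum /=.
have coeff b : (wcoeff g [:: a] [:: b] *: gen a (parr b))@_w =
    wcoeff g [:: a] [:: b] * (v == [:: b])%:R.
  rewrite mcoeffZ (mcoeff_gen _ _ ew) eqxx eq_sym /=; congr (_ * _%:R).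
  congr nat_of_bool; apply/eqP/eqP => [|/pword_arr //].
  by rewrite /v => ->.
rewrite (eq_bigr _ (fun b _ => coeff b)) -(wcoeff_odot _ ew) //.
have -> : (ptriv (src a) == (val w).2) = (v == [::]).
  rewrite eq_sym; apply/eqP/eqP => [|/pword_triv ->]; first by rewrite /v => ->.
  by have [<- _] := odot_cyclic w; rewrite ea.
case: (boolP (reduced a v)) => [|nred]; last first.
  rewrite g_red // big1 => [|b _].
    by case: eqP => [v0|_]; rewrite ?mulr0 ?addr0 // v0 in nred *.
  by case: eqP => [<-|_]; rewrite ?mulr0 // g_red ?mul0r.
case: {ew coeff} v => [|b []] // _.
  by rewrite eqxx mulr1 big1 ?addr0 // => b _; rewrite mulr0.
rewrite mulr0 add0r (bigD1 b) //= eqxx mulr1 big1 ?addr0 // => c cb.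
by rewrite eqseq_cons eq_sym (negbTE cb) mulr0.
Qed.

Hypothesis no_cycle : forall s, s <> [::] -> closedw s -> ~~ cycle nonrel s.

(** The case analysis of the introduction, on whether va and av contain a
    relation at the junction. *)
Lemma d0_rotate (z : {malg K[C1]}) (w : C1) a v :
  d1 z = 0 -> odot_words w = ([:: a], v) -> ~~ reduced a v ->
  (d0 (rotate z))@_w = z@_w.
Proof.
move=> dz ew; have Bv := odot_sorted ew.
have cl : closedw (a :: v) by have := odot_closedw w; rewrite ew.
rewrite (d0_coeff _ ew) -(wcoeff_odot z ew) // cats1 wcoeff_rotate //.
case/lastP: v Bv cl {ew} => // v b Bvb cl nred.
have clb : closedw (b :: a :: v).
  by apply: (@closedw_rot _ (a :: v) [:: b]); rewrite /= cats1.
have Bv : sorted nonrel v by move: Bvb; rewrite -cats1 => /cat_sorted2[].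
rewrite -[a :: rcons v b]/(rcons (a :: v) b) wcoeff_rotate //.
have : ~~ (sorted nonrel (rcons (a :: v) b) && nonrel b a).
  by have := no_cycle _ cl; rewrite /= rcons_path last_rcons; apply.
(* For the path vb, whose word is sorted, rotating a to the right creates the
   junction ba. *)
have -> : sorted nonrel (rcons (rcons v b) a) = nonrel b a.
  by rewrite -[rcons _ a]cats1 cat_rcons sorted_cat_cons Bvb /= andbT.
case: (boolP (nonrel b a)) => /= [_|rba _].
  by rewrite andbT => /negbTE->; rewrite subr0.
rewrite (cocycle_wcoeff dz) // sub0r; case: ifPn => // nav.
(* Neither rotation survives: if v is not empty, the word av contains a
   relation and the coefficient at (b, av) vanishes; if v is empty, the pair
   at hand is reduced. *)
rewrite [in RHS]wcoeff_not_sorted ?oppr0 //.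
case: v {cl clb Bv} nred nav Bvb => [|c v] /=.
  by rewrite rba !andbT negbK => ->.
by move=> _ + Bvb; rewrite Bvb andbT => /negbTE->.
Qed.

Lemma reducedC a b : reduced a [:: b] = reduced b [:: a].
Proof. by rewrite /= andbC. Qed.

Section Residue.

Variable z : {malg K[C1]}.
Hypothesis dz : d1 z = 0.
Notation g := (z - d0 (rotate z)).

Lemma residue_reduced a v : ~~ reduced a v -> wcoeff g [:: a] v = 0.
Proof.
move=> nred; case: (eqVneq (wcoeff g [:: a] v) 0) => // nz.
have [u ew] := wcoeff_neq0 nz; move: nz.
by rewrite (wcoeff_odot _ ew) // mcoeffB (d0_rotate dz ew) // subrr eqxx.
Qed.

(** On reduced pairs the residue has the coefficients of z itself, by
    d0_reduced; the rest is cocycle_wcoeff with v empty. *)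
Lemma residue_antisym a b : wcoeff g [:: a] [:: b] = - wcoeff g [:: b] [:: a].
Proof.
have residue_coeff c d (u : C1) : odot_words u = ([:: c], [:: d]) ->
    reduced c [:: d] -> wcoeff g [:: c] [:: d] = wcoeff z [:: c] [:: d].
  move=> eu red; rewrite !(wcoeff_odot _ eu) // mcoeffB.
  by rewrite (d0_reduced _ eu red) subr0.
have half c d : wcoeff g [:: c] [:: d] != 0 ->
    wcoeff g [:: c] [:: d] = - wcoeff g [:: d] [:: c].
  move=> nz; have [u eu] := wcoeff_neq0 nz.
  have red : reduced c [:: d].
    by apply: contraNT nz => /residue_reduced->.
  have cl : closedw [:: c; d] by have := odot_closedw u; rewrite eu.
  have /andP[_ rdc] := red.
  have zE := @cocycle_wcoeff z c d [::] dz rdc cl isT.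
  rewrite (residue_coeff _ _ _ eu red) [LHS]zE; congr (- _).
  have /wcoeff_neq0[t et] : wcoeff z [:: d] [:: c] != 0.
    by rewrite -oppr_eq0 -zE -(residue_coeff _ _ _ eu red).
  by rewrite (residue_coeff _ _ _ et) // reducedC.
case: (eqVneq (wcoeff g [:: a] [:: b]) 0) => [gab|/half //].
case: (eqVneq (wcoeff g [:: b] [:: a]) 0) => [->|/half ->].
  by rewrite gab oppr0.
by rewrite gab !oppr0.
Qed.

End Residue.

End Reduction.

(** * Linear combinations and pivots *)

Section Span.
Local Open Scope ring_scope.

Variables (K : fieldType) (V : lmodType K) (S : V -> Prop).

(** Lists of scaled elements add by concatenation; the form with a coefficient
    function on elements, which needs repetitions to be merged, is recovered in
    in_span_coefficients. *)
Definition in_span (x : V) : Prop :=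
  exists2 l : seq (K * V),
    forall i, i \in l -> S i.2 & x = \sum_(i <- l) i.1 *: i.2.

Lemma in_span0 : in_span 0.
Proof. by exists [::]; rewrite ?big_nil. Qed.

Lemma in_spanZ k x : S x -> in_span (k *: x).
Proof.
move=> Sx; exists [:: (k, x)]; rewrite ?big_seq1 // => i.
by rewrite inE => /eqP->.
Qed.

Lemma in_spanD x y : in_span x -> in_span y -> in_span (x + y).
Proof.
move=> [l Sl ->] [m Sm ->]; exists (l ++ m); last by rewrite big_cat.
by move=> i; rewrite mem_cat => /orP[/Sl|/Sm].
Qed.

Lemma in_span_sum (J : finType) (P : pred J) (F : J -> V) :
  (forall j, P j -> in_span (F j)) -> in_span (\sum_(j | P j) F j).
Proof.
by move=> SF; apply: big_ind => //; [exact: in_span0|exact: in_spanD].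
Qed.

Lemma in_span_coefficients x :
  in_span x ->
  exists (s : seq V) (c : V -> K),
    (forall y, y \in s -> S y) /\ x = \sum_(y <- s) c y *: y.
Proof.
case=> l Sl ->.
exists (undup (map snd l)), (fun y => \sum_(i <- l | i.2 == y) i.1); split.
  by move=> y; rewrite mem_undup => /mapP[i il ->]; exact: Sl.
under [RHS]eq_bigr => y _ do rewrite scaler_suml.
rewrite (exchange_big_dep predT) //=; apply: eq_big_seq => i il.
rewrite -big_filter (_ : filter _ _ = [:: i.2]) ?big_seq1 //.
rewrite (eq_filter (a2 := pred1 i.2)) => [|y]; last by rewrite /= eq_sym.
by rewrite filter_pred1_uniq ?undup_uniq // mem_undup map_f.
Qed.

End Span.

(** Triangularity in its simplest form: each x has a coordinate u that sees x
    but neither the other elements of S nor D, so u reads off the coefficient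
    of x in any combination that lies in D. *)
Lemma pivot_independent (K : fieldType) (T : choiceType)
    (S : {malg K[T]} -> Prop) (D : {malg K[T]} -> Prop) :
  (forall x, S x -> exists u,
    [/\ x@_u = 1, forall x', S x' -> x' != x -> x'@_u = 0
      & forall y, D y -> y@_u = 0])%R ->
  forall (s : seq {malg K[T]}) (c : {malg K[T]} -> K),
    uniq s -> (forall x, x \in s -> S x) ->
    D (\sum_(x <- s) c x *: x)%R -> forall x, x \in s -> c x = 0%R.
Proof.
move=> pivot s c us Ss Dsum x xs.
have [u [xu x'u /(_ _ Dsum)]] := pivot x (Ss x xs).
rewrite mcoeff_sum (bigD1_seq x) //= mcoeffZ xu mulr1.
rewrite big_seq_cond big1 ?addr0 //.
by move=> y /andP[ys yx]; rewrite mcoeffZ x'u ?mulr0 //; exact: Ss.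
Qed.

Section Basis.
Local Open Scope ring_scope.

Variables (K : fieldType) (Q : quiver) (I : path_alg K Q -> Prop).
Variables (R : {fset qpath Q}) (o : rel (arrow Q)).
Hypothesis R_quadratic : forall p, p \in R -> plen p = 2%N.
Hypothesis R_gen : generated_by R I.
Hypothesis o_orientation : orientation o.

Notation C0 := (odot (@pathQ0 Q) (pathB R)).
Notation C1 := (odot (@pathQ1 Q) (pathB R)).
Notation C2 := (odot (pathR R) (pathB R)).
Notation basis_elt := (@HH1_dual_basis_elt K Q I R o).
Notation gen a p := (odot_term K (@pathQ1 Q) (pathB R) (parr a) (Some p)).

Lemma val_words (u : C1) a b :
  odot_words u = ([:: a], [:: b]) -> val u = (parr a, parr b).
Proof.
by case=> /pword_arr e1 /pword_arr e2; rewrite [val u]surjective_pairing e1 e2.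
Qed.

Lemma odot_words_val (u : C1) p q :
  val u = (p, q) -> odot_words u = (pword p, pword q).
Proof. by rewrite /odot_words => ->. Qed.

(** At the relation ba with word v, only v = [::] can matter; then the two
    terms of d1_coeff cancel for a pair, and add up to 2 for (a, a^* ). *)
Lemma basis_elt_cocycle x : basis_elt x -> d1 x = 0.
Proof.
move=> Sx; apply/malgP => w; rewrite mcoeff0.
have [b [a ew]] : exists b a, odot_words w = ([:: b; a], pword (val w).2).
  have : (val w).1 \in R by case/and3P: (valP w).
  move/R_quadratic; rewrite /plen /odot_words.
  by case: (pword (val w).1) => [|b [|a []]] // _; exists b, a.
rewrite (d1_coeff R_quadratic x ew).
have rconsE c d v : ([:: c] == v ++ [:: d]) = (v == [::]) && (c == d).
  by case: v => [|e [|? ?]]; rewrite //= eqseq_cons ?andbT ?andbF.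
have consE c d v : ([:: c] == d :: v) = (v == [::]) && (c == d).
  by rewrite eqseq_cons andbC eq_sym.
case: Sx => {x} [c d u v /odot_words_val eu /odot_words_val ev _ _ _ _
  |c e u /odot_words_val eu|c u char2 /odot_words_val eu].
- rewrite (wcoeffUB _ u v) (wcoeffUB _ u v) eu ev /=.
  rewrite !xpair_eqE !rconsE !consE eqxx.
  case: (pword (val w).2 == [::]); rewrite /= ?andbF ?subrr ?addr0 //.
  rewrite [(d == b) && _]andbC [(c == b) && _]andbC.
  by rewrite addrACA -opprD [X in _ - X]addrC subrr.
- rewrite 2!(wcoeffU _ u) eu /= !xpair_eqE /=.
  by rewrite [[::] == _]eq_sym -size_eq0 size_cat addn1 !andbF addr0.
rewrite 2!(wcoeffU _ u) eu /= !xpair_eqE rconsE !consE eqxx.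
case: (pword (val w).2 == [::]); rewrite /= ?andbF ?addr0 //.
rewrite [(c == a) && _]andbC.
by case: (_ && _); rewrite ?addr0 // -mulr2n; case/andP: char2 => _ /eqP.
Qed.

(** The pivot of (a, b^* ) - (b, a^* ) is (a, b^* ), which no other pair
    element involves since o selects only one of (a, b) and (b, a); the pivots
    of the other elements are the elements themselves. *)
Lemma basis_elt_pivot x : basis_elt x -> exists u,
  [/\ x@_u = 1, forall x', basis_elt x' -> x' != x -> x'@_u = 0
    & forall y : {malg K[C0]}, (d0 y)@_u = 0].
Proof.
case=> [a b u v /odot_words_val wu /odot_words_val wv ab oab Iab Iba
  |a e u /odot_words_val wu|a u char2 /odot_words_val wu];
  exists u; split.
- rewrite mcoeffUB eqxx; case: eqP => [vu|]; last by rewrite subr0.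
  by move: wv ab; rewrite vu wu => -[->]; rewrite eqxx.
- move=> _ [c d u' v' /odot_words_val wu' /odot_words_val wv' cd ocd _ _
    |c e u' /odot_words_val wu'|c u' _ /odot_words_val wu'] ne.
  + rewrite mcoeffUB.
    case: (eqVneq v' u) => [vu|_].
      move: wv'; rewrite vu wu => -[ad bc]; move: oab.
      by rewrite ad bc (o_orientation _) ?ocd // eq_sym.
    case: (eqVneq u' u) => [uu|_]; last by rewrite subr0.
    case/eqP: ne; rewrite uu; congr (_ - << _ >>).
    apply: odot_words_inj; rewrite wv' ?wv //.
    by move: wu'; rewrite uu wu => -[-> ->].
  + by rewrite mcoeffU; case: eqP => // uu; move: wu'; rewrite uu wu.
  + rewrite mcoeffU; case: eqP => // uu; move: wu' ab.
    by rewrite uu wu => -[-> ->]; rewrite eqxx.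
- move=> y; apply: (d0_reduced R_quadratic y wu) => /=.
  have wf2 (t : C1) c d :
      odot_words t = ([:: c], [:: d]) -> exists p, pword p = [:: c; d].
    move=> et; have := odot_closedw t; rewrite et.
    by case=> z [/qpath_of_word[p _ pw] _]; exists p.
  have [p pw] := wf2 _ _ _ wu; have [q qw] := wf2 _ _ _ wv.
  have rel_ab := (ideal_arr_mul R_quadratic R_gen pw).1 Iab.
  by rewrite rel_ab (ideal_arr_mul R_quadratic R_gen qw).1.
- by rewrite mcoeffU eqxx.
- move=> _ [c d u' v' /odot_words_val wu' /odot_words_val wv' cd ocd _ _
    |c e' u' /odot_words_val wu'|c u' _ /odot_words_val wu'] ne.
  + rewrite mcoeffUB.
    case: (eqVneq u' u) => [uu|_]; first by move: wu'; rewrite uu wu.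
    case: (eqVneq v' u) => [vu|_]; first by move: wv'; rewrite vu wu.
    by rewrite subr0.
  + by rewrite mcoeffU; case: eqP => // uu; rewrite uu eqxx in ne.
  + by rewrite mcoeffU; case: eqP => // uu; move: wu'; rewrite uu wu.
- by move=> y; exact: (d0_reduced R_quadratic y wu).
- by rewrite mcoeffU eqxx.
- move=> _ [c d u' v' /odot_words_val wu' /odot_words_val wv' cd ocd _ _
    |c e' u' /odot_words_val wu'|c u' _ /odot_words_val wu'] ne.
  + rewrite mcoeffUB.
    case: (eqVneq u' u) => [uu|_].
      by move: wu' cd; rewrite uu wu => -[<- <-]; rewrite eqxx.
    case: (eqVneq v' u) => [vu|_]; last by rewrite subr0.
    by move: wv' cd; rewrite vu wu => -[<- <-]; rewrite eqxx.
  + by rewrite mcoeffU; case: eqP => // uu; move: wu'; rewrite uu wu.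
  + by rewrite mcoeffU; case: eqP => // uu; rewrite uu eqxx in ne.
by move=> y; rewrite (d0_coeff y wu) subrr.
Qed.

Lemma gen_words (u : C1) a p : val u = (parr a, p) -> gen a p = << u >>.
Proof. by move=> eu; rewrite -(odot_termE K u) eu. Qed.

(** Antisymmetry folds the sum over ordered pairs of distinct arrows onto the
    pairs selected by o, and makes twice each diagonal coefficient vanish. *)
Lemma reduced_in_span (g : {malg K[C1]}) :
  (forall a v, ~~ reduced R a v -> wcoeff g [:: a] v = 0) ->
  (forall a b, wcoeff g [:: a] [:: b] = - wcoeff g [:: b] [:: a]) ->
  in_span basis_elt g.
Proof.
move=> g_red g_anti; rewrite (reduced_expansion g_red).
pose G a b := wcoeff g [:: a] [:: b].
have nz a b : G a b != 0 -> exists2 u : C1, val u = (parr a, parr b) &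
    I (arr_mul K a b).
  move=> nzab; have [u eu] := wcoeff_neq0 nzab.
  exists u; first exact: val_words.
  have /andP[rab _] : reduced R a [:: b].
    by apply: contraNT nzab => /g_red h; rewrite /G h.
  have := odot_closedw u; rewrite eu => -[x [/qpath_of_word[p _ pw] _]].
  exact/(ideal_arr_mul R_quadratic R_gen pw).
apply: in_spanD.
  apply: in_span_sum => a _.
  case: (eqVneq (wcoeff g [:: a] [::]) 0) => [->|/wcoeff_neq0[u eu]].
    by rewrite scale0r; exact: in_span0.
  have uE : val u = (parr a, ptriv (src a)).
    have [c1 _] := odot_cyclic u; move: eu => [/pword_arr e1 /pword_triv e2].
    by rewrite [val u]surjective_pairing e2 -c1 e1.
  by rewrite (gen_words uE); apply/in_spanZ/HH1_dual_loop/uE.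
rewrite pair_big /=.
rewrite (bigID (fun i => i.1 == i.2)) /=; apply: in_spanD.
  apply: in_span_sum => -[a b] /= /eqP <-.
  case: (eqVneq (G a a) 0) => [e|nzaa].
    by rewrite -/(G a a) e scale0r; exact: in_span0.
  have [u uE _] := nz _ _ nzaa; rewrite (gen_words uE).
  apply/in_spanZ/HH1_dual_char2/uE; rewrite inE /=.
  have : 2%:R * G a a == 0 by rewrite mulr_natl mulr2n addr_eq0 {1}/G g_anti.
  by rewrite mulf_eq0 (negbTE nzaa) orbF.
rewrite (bigID (fun i => o i.1 i.2)) /=.
have swapK : involutive (fun i : arrow Q * arrow Q => (i.2, i.1)) by case.
rewrite [X in _ + X](reindex_inj (inv_inj swapK)) /=.
rewrite [X in _ + X](eq_bigl (fun i => (i.1 != i.2) && o i.1 i.2)); last first.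
  move=> [a b] /=; rewrite eq_sym; case: (eqVneq a b) => //= ab.
  by rewrite (o_orientation ab).
rewrite -big_split; apply: in_span_sum => -[a b] /= /andP[ab oab].
rewrite (g_anti b a) -/(G a b) scaleNr -scalerBr.
case: (eqVneq (G a b) 0) => [->|nzab].
  by rewrite scale0r; exact: in_span0.
have [u uE Iab] := nz _ _ nzab.
have [|v vE Iba] := nz b a; first by rewrite /G g_anti oppr_eq0.
rewrite (gen_words uE) (gen_words vE); apply: in_spanZ.
exact: HH1_dual_pair uE vE ab oab Iab Iba.
Qed.

End Basis.

Theorem theorem3p19 (K : fieldType) (Q : quiver) (I : path_alg K Q -> Prop)
    (R : {fset qpath Q}) (o : rel (arrow Q))
    (hA : gentle I)
    (hK : ~ (#|vertex Q| = 1 /\ #|arrow Q| = 0))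
    (hKx : ~ (#|vertex Q| = 1 /\ #|arrow Q| = 1))
    (hR : minimal_quadratic_generators I R)
    (ho : orientation o) :
  classes_form_basis (@d0 K Q R) (@d1 K Q R) (@HH1_dual_basis_elt K Q I R o).
Proof.
have [[R_quadratic R_gen] _] := hR.
split=> [x|s c us Ss [y sE]|z dz].
- exact: basis_elt_cocycle.
- apply: (@pivot_independent _ _ _ (fun x => exists y, x = d0 y)) us Ss _;
    last by exists y.
  move=> x /(basis_elt_pivot R_quadratic R_gen ho)[u [xu x'u d0u]].
  by exists u; split=> // _ [y' ->].
have nc := no_nonrel_cycle R_quadratic R_gen (gentle_fd hA).
have [] := @in_span_coefficients _ _ (HH1_dual_basis_elt I o)
  (z - d0 (rotate z))%R.
  apply: reduced_in_span => // a v.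
    exact: residue_reduced.
  exact: residue_antisym.
move=> s [c [Ss zE]]; exists s, c, (rotate z); split=> //.
by rewrite -zE subrK.
Qed.
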